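(* Let $\lambda>0$, $V=(V^x,V^y)\in\mathbb{R}^2$, $(s_q,s_{xy})\in\mathbb{R}^2$. Consider the twisted $D_2Q_4$ scheme relative to $\tilde u=V$ with relaxation parameters $(0,s_q,s_q,s_{xy})$ and equilibrium moments $m^{eq}(V)=\rho(1,0,0,0)$. Put $W^x=V^x+V^y$, $W^y=V^x-V^y$ and $\gamma=s_{xy}/(2s_q-s_{xy})$. Denote by (H) the system of inequalities (both signs $\pm$ required) $$(W^x\pm2\lambda\gamma)^2-(W^y)^2\ge\frac{16\lambda^2}{(2s_q-s_{xy})^2}\big(s_{xy}-s_q(2-s_q)\big),\qquad (W^y\pm2\lambda\gamma)^2-(W^x)^2\ge\frac{16\lambda^2}{(2s_q-s_{xy})^2}\big(s_{xy}-s_q(2-s_q)\big).$$ \begin{itemize} \item If $s_q\le s_{xy}\le\min(1,2s_q)$, the scheme is $L^\infty$ stable on $|V|_\infty\le\lambda$. \item If $s_{xy}<2s_q$ and $\max(s_q,1)\le s_{xy}\le2(2-s_q)$, the scheme is $L^\infty$ stable on the intersection of $|V|_\infty\le\lambda$ with (H). \item If $0\le s_{xy}\le\min(s_q,s_q(2-s_q))$, the scheme is $L^\infty$ stable on $|V|_\infty\le\lambda\gamma$. \item If $s_q(2-s_q)\le s_{xy}\le\min(s_q,2(2-s_q))$, the scheme is $L^\infty$ stable on (H). \item For all other $(s_q,s_{xy})$ (covered by no item of this list), no $V$ corresponds to an $L^\infty$ stable scheme. \item If $s_{xy}=2s_q$ and $0<s_{xy}\le2$, the scheme is $L^\infty$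 stable on the intersection of $|V|_\infty\le\lambda$ and $$|V|_1\le2\lambda\Big(\frac{2-s_{xy}}{s_{xy}}\Big).$$ \item If $s_{xy}=s_q=0$, the scheme is unconditionally $L^\infty$ stable (i.e. for every $V\in\mathbb{R}^2$). \end{itemize} In particular, the parameters $(s_q,s_{xy})$ corresponding to a non-empty area of $L^\infty$ stability in $V$ are included in the square $[0,2]^2$.
   Context: $|V|_\infty=\max(|V^x|,|V^y|)$ and $|V|_1=|V^x|+|V^y|$. Twisted $D_2Q_4$ scheme. Let $\Delta x,\Delta t>0$, $\lambda=\Delta x/\Delta t$, $\mathcal{L}=\Delta x\,\mathbb{Z}^2$. Velocities: $v_0=(\lambda,\lambda)$, $v_1=(-\lambda,\lambda)$, $v_2=(-\lambda,-\lambda)$, $v_3=(\lambda,-\lambda)$. Moment polynomials: $P_0=1$, $P_1=X$, $P_2=Y$, $P_3=XY$. For $\tilde u\in\mathbb{R}^2$, $M(\tilde u)$ is the invertible $4\times4$ matrix $M(\tilde u)_{kj}=P_k(v_j-\tilde u)$. For a distribution vector $f=(f_0,\dots,f_3)$ put $\rho=\sum_jf_j$ and $m=M(\tilde u)f$. One time step of the scheme relative to $\tilde u$ with relaxation parameters $(s_0,\dots,s_3)$ is: relaxation at each node $m_k^*=m_k+s_k(m_k^{eq}-m_k)$, where $m^{eq}$ is a given linear function of $\rho$; $f^*=M(\tilde u)^{-1}m^*$; transport $f_j(x,t+\Delta t)=f_j^*(x-v_j\Delta t,t)$, $x\in\mathcal{L}$. $L^\infty$ stability. The mass is $m_{tot}(t)=\sum_{x\in\mathcal{L}}\sum_jf_j(x,t)$.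 The scheme is $L^\infty$ stable if, for $C>0$ and every initial datum with $f_j(x,0)\ge0$ for all $j$, $x\in\mathcal{L}$ and $m_{tot}(0)\le C$, one has $f_j(x,t^n)\ge0$ for all $j$, $x\in\mathcal{L}$ and $m_{tot}(t^n)\le C$ for all $t^n=n\Delta t$, $n\in\mathbb{N}$.
   Formalization: The fourth item also assumes s_xy>0, as it is false without it (e.g. (s_q,s_xy)=(-1,-3) with V=0; (2,0)); ''all other parameters'' in the fifth item is taken relative to this corrected list. At (0,0), where γ is undefined, γ is read as 0 in the third item. *)

(* Defs.v *)
From HB Require Import structures.
From mathcomp Require Import all_boot all_order all_algebra.
From mathcomp Require Import all_classical all_reals all_analysis.
From mathcomp Require Import ring lra.

Set Implicit Arguments.
Unset Strict Implicit.
Unset Printing Implicit Defensive.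

Import Order.TTheory GRing.Theory Num.Theory.
Local Open Scope classical_set_scope.
Local Open Scope ring_scope.

Section TwistedD2Q4.
Variable R : realType.
Implicit Types (dx dt lambda sq sxy : R) (u V x : R * R) (s e m : 'cV[R]_4).

Definition norm_inf V : R := Num.max `|V.1| `|V.2|.
Definition norm_one V : R := `|V.1| + `|V.2|.

Definition lattice dx : set (R * R) :=
  [set x | exists a b : int, x = (dx * a%:~R, dx * b%:~R)].

Definition velocity lambda (j : 'I_4) : R * R :=
  [:: (lambda, lambda); (- lambda, lambda);
      (- lambda, - lambda); (lambda, - lambda)]`_j.

Definition moment_poly (k : 'I_4) x : R := [:: 1; x.1; x.2; x.1 * x.2]`_k.

Definition moment_mx lambda u : 'M[R]_4 :=
  \matrix_(k, j) moment_poly k (velocity lambda j - u).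

(* [invmx] is total; this makes its use in [collide] the genuine inverse. *)
Lemma moment_mx_unit lambda u : lambda != 0 -> moment_mx lambda u \in unitmx.
Proof.
move=> l0.
pose a (j : 'I_4) : R := [:: 1; -1; -1; 1]`_j.
pose b (j : 'I_4) : R := [:: 1; 1; -1; -1]`_j.
pose N : 'M[R]_4 := \matrix_(j, k)
  (4^-1 * [:: (1 + a j * u.1 / lambda) * (1 + b j * u.2 / lambda);
              a j / lambda * (1 + b j * u.2 / lambda);
              b j / lambda * (1 + a j * u.1 / lambda);
              a j * b j / lambda ^+ 2]`_k).
suff /mulmx1_unit[]: moment_mx lambda u *m N = 1%:M by [].
apply/matrixP => i k; rewrite !mxE !big_ord_recl big_ord0 !mxE.
rewrite /moment_poly /velocity /a /b.
case: i => [] [|[|[|[|i]]]] // ?; case: k => [] [|[|[|[|k]]]] // ?;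
  rewrite /= ?mulr1n ?mulr0n; field; exact: l0.
Qed.

(* The linear map rho |-> m^eq is given by its value e at rho = 1. *)
Definition relax s e (rho : R) m : 'cV[R]_4 :=
  \col_k (m k 0 + s k 0 * ((rho *: e) k 0 - m k 0)).

Definition density (g : 'cV[R]_4) : R := \sum_j g j 0.

Definition collide lambda u s e (g : 'cV[R]_4) : 'cV[R]_4 :=
  invmx (moment_mx lambda u) *m
    relax s e (density g) (moment_mx lambda u *m g).

(* A distribution is a function of all points of the plane, but only its
   values on [lattice dx] matter: each shift by [velocity (dx / dt) j * dt]
   preserves the lattice, and [Linf_stable] only looks at lattice nodes. *)
Definition step dx dt u s e (f : R * R -> 'cV[R]_4) : R * R -> 'cV[R]_4 :=
  fun x => \col_j
    let v := velocity (dx / dt) j in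
    collide (dx / dt) u s e (f (x.1 - v.1 * dt, x.2 - v.2 * dt)) j 0.

(* [esum] is the supremum of the finite partial sums, i.e. the sum of the
   family (possibly +oo) when its terms are nonnegative; in [Linf_stable] it
   always comes together with the nonnegativity of [f] on the lattice. *)
Definition mass dx (f : R * R -> 'cV[R]_4) : \bar R :=
  \esum_(x in lattice dx) (density (f x))%:E.

Definition nonneg dx (f : R * R -> 'cV[R]_4) : Prop :=
  forall x, lattice dx x -> forall j, 0 <= f x j 0.

Definition Linf_stable dx dt u s e : Prop :=
  forall C : R, 0 < C ->
  forall f0 : R * R -> 'cV[R]_4,
    nonneg dx f0 -> (mass dx f0 <= C%:E)%E ->
  forall n : nat,
    nonneg dx (iter n (step dx dt u s e) f0) /\
    (mass dx (iter n (step dx dt u s e) f0) <= C%:E)%E.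

Definition stable dx dt sq sxy V : Prop :=
  Linf_stable dx dt V (\col_k [:: 0; sq; sq; sxy]`_k) (\col_k [:: 1; 0; 0; 0]`_k).

(* Division by zero is zero here: gamma 0 0 = 0, whereas gamma is undefined at
   sxy = 2 * sq on paper. The bound norm_inf V <= lambda * gamma sq sxy then
   only allows V = 0 at (0, 0), where every V is stable anyway. *)
Definition gamma sq sxy : R := sxy / (2 * sq - sxy).

Definition condH lambda sq sxy V : Prop :=
  let Wx := V.1 + V.2 in
  let Wy := V.1 - V.2 in
  let g := 2 * lambda * gamma sq sxy in
  let B := 16 * lambda ^+ 2 / (2 * sq - sxy) ^+ 2 * (sxy - sq * (2 - sq)) in
  [/\ (Wx + g) ^+ 2 - Wy ^+ 2 >= B, (Wx - g) ^+ 2 - Wy ^+ 2 >= B,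
      (Wy + g) ^+ 2 - Wx ^+ 2 >= B & (Wy - g) ^+ 2 - Wx ^+ 2 >= B].

Definition params1 sq sxy : Prop := sq <= sxy <= Num.min 1 (2 * sq).

Definition params2 sq sxy : Prop :=
  sxy < 2 * sq /\ Num.max sq 1 <= sxy <= 2 * (2 - sq).

Definition params3 sq sxy : Prop :=
  0 <= sxy <= Num.min sq (sq * (2 - sq)).

(* 0 < sxy is needed for (H) alone to imply stability. If sxy < 0, no V is
   stable, yet V = 0 satisfies (H) at (sq, sxy) = (-1, -3), for instance. At
   (2, 0), (H) says V.1 * V.2 = 0 but only V = 0 is stable. The two points
   discarded with sxy = 0, (0, 0) and (2, 0), belong to [params3]. *)
Definition params4 sq sxy : Prop :=
  0 < sxy /\ sq * (2 - sq) <= sxy <= Num.min sq (2 * (2 - sq)).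

Definition params5 sq sxy : Prop := sxy = 2 * sq /\ 0 < sxy <= 2.

Definition params6 sq sxy : Prop := sxy = 0 /\ sq = 0.

End TwistedD2Q4.

(* Main.v *)
Require Import Defs.
From mathcomp Require Import all_boot all_order all_algebra.
From mathcomp Require Import all_classical all_reals all_analysis.
From mathcomp Require Import ring lra.

Import Order.TTheory GRing.Theory Num.Theory.
Local Open Scope ring_scope.

(** The total mass is conserved because the first moment, the density, is not
    relaxed and the transport permutes the nodes of the lattice. So stability
    only asks for nonnegativity, and it holds exactly when the collision at one
    node preserves nonnegative vectors: a Dirac mass placed upstream of a node
    detects any negative output ([Linf_stableP]).

    The collision is linear in the distribution, so this means that the sixteen
    entries of its matrix are nonnegative. In the variables [X = V.1 / lambda],
    [Y = V.2 / lambda], the entry sending velocity [i] to velocity [j] depends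
    on [x = +-X] and [y = +-Y], the signs being those of [j], and on whether [i]
    and [j] agree in each component. Up to the factor 1/4 it is
    - [4 - 2 s (1 - x y) - sxy (1 - x) (1 - y)] when [i = j],
    - [(1 + y) (sxy + d x)] or [(1 + x) (sxy + d y)] when one component differs,
    - [d (1 + x) (1 + y)] when both differ,
    where [d = 2 s - sxy] ([collision_mx_ge0P]).

    All signs being present, these conditions say that [d >= 0] and, if [d > 0],
    that [|X|] and [|Y|] are at most [min 1 (sxy / d)] and that the first weight
    is nonnegative. Multiplied by [d], the first weight becomes
    [(d x + sxy) (d y + sxy) - 4 (sxy - s (2 - s))], whose nonnegativity is (H).
    The regions of parameters differ in which of these constraints imply the
    others. If [d = 0], the first weight is [4 - 2 sxy + sxy (x + y)], whence
    the bound on [|X| + |Y|].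

    Averaging the first weight over the four choices of signs gives
    [sxy <= 2 (2 - s)], and averaging the second one over [x = +-X] at [y = |Y|]
    gives [sxy >= 0]; together with [d >= 0], this leaves no parameters outside
    the listed regions ([params_of_nonneg_weights]). *)

Section Stability.
Variable R : realType.

(** * Stability as positivity of the collision *)

Definition upwind (dx dt : R) (j : 'I_4) (x : R * R) : R * R :=
  (x.1 - (velocity (dx / dt) j).1 * dt, x.2 - (velocity (dx / dt) j).2 * dt).

Lemma stepE (dx dt : R) u (s e : 'cV[R]_4) f x j :
  step dx dt u s e f x j 0 =
  collide (dx / dt) u s e (f (upwind dx dt j x)) j 0.
Proof. by rewrite mxE. Qed.

Lemma velocity_node (dx dt : R) (j : 'I_4) : dt != 0 ->
  exists a b : int, forall x : R * R,
    upwind dx dt j x = (x.1 + dx * a%:~R, x.2 + dx * b%:~R).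
Proof.
move=> dt0; rewrite /upwind /velocity.
case: j => [] [|[|[|[|j]]]] //= _;
  [exists (-1), (-1)|exists 1, (-1)|exists 1, 1|exists (-1), 1] => x;
  rewrite ?mulrN1 ?rmorphN ?rmorph1 ?mulr1 ?mulNr ?divfK // ?opprK ?mulrN1 //.
Qed.

Lemma lattice_shift_bij (dx : R) (a b : int) :
  set_bij (lattice dx) (lattice dx)
    (fun x : R * R => (x.1 + dx * a%:~R, x.2 + dx * b%:~R)).
Proof.
split.
- move=> x [k [l ->]] /=; exists (k + a), (l + b).
  by rewrite !rmorphD /= !mulrDr.
- by move=> [x1 x2] [y1 y2] _ _ /= [/addIr -> /addIr ->].
- move=> x [k [l ->]]; exists (dx * (k - a)%:~R, dx * (l - b)%:~R) => /=.
    by exists (k - a), (l - b).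
  by rewrite !rmorphB /= -!mulrDr !subrK.
Qed.

Lemma transport_bij (dx dt : R) (j : 'I_4) : dt != 0 ->
  set_bij (lattice dx) (lattice dx) (upwind dx dt j).
Proof.
move=> dt0; have [a [b ab]] := velocity_node dx dt j dt0.
by have /funext -> := ab; apply: lattice_shift_bij.
Qed.

Definition nonneg_vec (g : 'cV[R]_4) : Prop := forall j, 0 <= g j 0.

Lemma density_moment0 (lambda : R) u (g : 'cV[R]_4) :
  (moment_mx lambda u *m g) 0 0 = density g.
Proof.
by rewrite mxE /density; apply: eq_bigr => j _; rewrite mxE /moment_poly mul1r.
Qed.

Lemma density_collide (lambda : R) u (s e g : 'cV[R]_4) :
  lambda != 0 -> s 0 0 = 0 -> density (collide lambda u s e g) = density g.
Proof.
move=> l0 s0; rewrite -(density_moment0 lambda u) /collide.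
rewrite mulKVmx; last exact: moment_mx_unit.
by rewrite [LHS]mxE s0 mul0r addr0 density_moment0.
Qed.

(** The populations of each velocity are summed separately, since each of them
    is moved by its own bijection of the lattice; this needs nonnegative
    populations after the collision, for the infinite sums to add up. *)
Lemma mass_step (dx dt : R) u (s e : 'cV[R]_4) (f : R * R -> 'cV[R]_4) :
  0 < dx -> 0 < dt -> s 0 0 = 0 ->
  (forall x, lattice dx x -> nonneg_vec (collide (dx / dt) u s e (f x))) ->
  mass dx (step dx dt u s e f) = mass dx f.
Proof.
move=> dx0 dt0 s0 fpos; rewrite /mass.
have dtN0 : dt != 0 by rewrite gt_eqF.
have lN0 : dx / dt != 0 by rewrite gt_eqF // divr_gt0.
pose F (y : R * R) (j : 'I_4) : \bar R :=
  (collide (dx / dt) u s e (f y) j 0)%:E.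
transitivity (\sum_(j < 4) \esum_(x in lattice dx) F x j)%E; last first.
  rewrite -esum_sum => [|x j xL _]; last by rewrite lee_fin fpos.
  apply: eq_esum => x _.
  by rewrite sumEFin -(density_collide (dx / dt) u s e).
transitivity (\sum_(j < 4) \esum_(x in lattice dx)
  F (upwind dx dt j x) j)%E; last first.
  apply: eq_bigr => j _; symmetry.
  by rewrite (reindex_esum _ _ _ _ (transport_bij dx dt j dtN0)).
rewrite -esum_sum => [|x j xL _].
  by apply: eq_esum => x _; rewrite sumEFin; congr EFin;
    apply: eq_bigr => j _; rewrite stepE.
rewrite lee_fin; apply: fpos.
by have [/(_ _ xL)] := transport_bij dx dt j dtN0.
Qed.

Lemma lattice0 (dx : R) : lattice dx (0, 0).
Proof. by exists 0, 0; rewrite !mulr0. Qed.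

(** Nonnegativity and mass propagate by induction. Conversely, the datum [g] at
    the origin and 0 elsewhere is admissible, and after one step the [j]-th
    population at the node downstream of the origin is that of the collided
    [g]. *)
Lemma Linf_stableP (dx dt : R) u (s e : 'cV[R]_4) :
  0 < dx -> 0 < dt -> s 0 0 = 0 ->
  Linf_stable dx dt u s e <->
  (forall g, nonneg_vec g -> nonneg_vec (collide (dx / dt) u s e g)).
Proof.
move=> dx0 dt0 s0; have dtN0 : dt != 0 by rewrite gt_eqF.
split=> [st g g0 j|pos C C0 f0 f0pos f0C]; last first.
  elim=> [//|n [fpos fC]]; rewrite iterS; split; last first.
    by rewrite mass_step // => x xL; apply: pos => j; apply: fpos.
  move=> x xL j; rewrite stepE; apply: pos => i; apply: fpos.
  by have [/(_ _ xL)] := transport_bij dx dt j dtN0.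
pose f0 (x : R * R) : 'cV[R]_4 := if x == (0, 0) then g else 0.
have f0pos : nonneg dx f0.
  by move=> x _ i; rewrite /f0; case: ifP => _; rewrite ?mxE.
have dens0 : 0 <= density g by apply: sumr_ge0 => i _; apply: g0.
have f0mass : (mass dx f0 <= (density g + 1)%:E)%E.
  rewrite /mass (esumID [set (0, 0)]%classic) => [|x xL]; last first.
    by rewrite lee_fin; apply: sumr_ge0 => i _; apply: f0pos.
  rewrite [X in (_ + X)%E]esum1 => [|x [_ /= /eqP/negPf x0]]; last first.
    by rewrite /f0 x0 /density big1 // => i _; rewrite mxE.
  rewrite (_ : (lattice dx `&` _)%classic = [set (0, 0)]%classic); last first.
    by apply/seteqP; split=> x [] // ->; split=> //; apply: lattice0.
  by rewrite adde0 esum_set1 /f0 eqxx lee_fin ?lerDl.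
have C0 : 0 < density g + 1 by rewrite ltr_wpDl.
have [_ surj] := transport_bij dx dt j dtN0.
move=> /(_ (0, 0) (lattice0 dx)) [x xL x0].
have [/(_ x xL j) + _] := st _ C0 f0 f0pos f0mass 1%N.
by rewrite /= stepE x0 /f0 eqxx.
Qed.

(** * The weights of the collision *)

Implicit Types (s sxy X Y x y : R).

Definition signx (j : 'I_4) : R := [:: 1; -1; -1; 1]`_j.
Definition signy (j : 'I_4) : R := [:: 1; 1; -1; -1]`_j.

(** The differences [signx i - X], [signy i - Y] and their product are the
    moments of a unit mass of velocity [i], in units of [lambda]. Each of them
    is relaxed towards 0 and multiplied by the population of velocity [j] in the
    distribution where that moment is 1 and the other three vanish. *)
Definition collision_mx s sxy X Y : 'M[R]_4 := \matrix_(j, i)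
  (4^-1 * ((1 + signx j * X) * (1 + signy j * Y)
    + (1 - s) * (signx j * (signx i - X) * (1 + signy j * Y))
    + (1 - s) * (signy j * (signy i - Y) * (1 + signx j * X))
    + (1 - sxy) * (signx j * (signx i - X) * (signy j * (signy i - Y))))).

(** Both sides have the same moments, and the moments determine the
    distribution. *)
Lemma collideE (lambda : R) s sxy X Y (g : 'cV[R]_4) : lambda != 0 ->
  collide lambda (lambda * X, lambda * Y)
    (\col_k [:: 0; s; s; sxy]`_k) (\col_k [:: 1; 0; 0; 0]`_k) g =
  collision_mx s sxy X Y *m g.
Proof.
move=> l0; rewrite /collide.
set M := moment_mx _ _.
suff -> : relax (\col_k [:: 0; s; s; sxy]`_k) (\col_k [:: 1; 0; 0; 0]`_k)
    (density g) (M *m g) = M *m (collision_mx s sxy X Y *m g).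
  by rewrite mulKmx //; apply: moment_mx_unit.
apply/matrixP => k i; rewrite ord1 !mxE /density !big_ord_recl !big_ord0.
rewrite !mxE !big_ord_recl !big_ord0 !mxE.
rewrite /moment_poly /velocity /signx /signy.
case: k => [] [|[|[|[|k]]]] //= ?; by field.
Qed.

Lemma collide_nonnegP (lambda : R) s sxy X Y : lambda != 0 ->
  (forall g, nonneg_vec g ->
     nonneg_vec (collide lambda (lambda * X, lambda * Y)
       (\col_k [:: 0; s; s; sxy]`_k) (\col_k [:: 1; 0; 0; 0]`_k) g)) <->
  (forall j i, 0 <= collision_mx s sxy X Y j i).
Proof.
move=> l0; split=> [pos j i|pos g g0 j]; last first.
  by rewrite collideE // mxE; apply: sumr_ge0 => i _; rewrite mulr_ge0.
have /pos/(_ j) : nonneg_vec (delta_mx i 0) by move=> k; rewrite mxE ler0n.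
by rewrite collideE // -colE mxE.
Qed.

(** The signs of the two components of a velocity act on [X] and [Y]; the
    equations on norms range over the four choices of these signs. *)
Definition nonneg_weights s sxy X Y : Prop :=
  forall x y, `|x| = `|X| -> `|y| = `|Y| ->
  [/\ 0 <= 4 - 2 * s * (1 - x * y) - sxy * ((1 - x) * (1 - y)),
      0 <= (1 + y) * (sxy + (2 * s - sxy) * x),
      0 <= (1 + x) * (sxy + (2 * s - sxy) * y) &
      0 <= (2 * s - sxy) * ((1 + x) * (1 + y))].

Lemma collision_mx_ge0P s sxy X Y :
  (forall j i, 0 <= collision_mx s sxy X Y j i) <-> nonneg_weights s sxy X Y.
Proof.
split=> [pos x y /eqP + /eqP|pos j i].
  rewrite !eqr_norm2 => /orP[] /eqP -> /orP[] /eqP ->.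
  - have := (pos 0 0, pos 0 1, pos 0 2, pos 0 3).
    by rewrite !mxE /signx /signy /= => -[[[? ?] ?] ?]; split; lra.
  - have := (pos 3 0, pos 3 1, pos 3 2, pos 3 3).
    by rewrite !mxE /signx /signy /= => -[[[? ?] ?] ?]; split; lra.
  - have := (pos 1 0, pos 1 1, pos 1 2, pos 1 3).
    by rewrite !mxE /signx /signy /= => -[[[? ?] ?] ?]; split; lra.
  - have := (pos 2 0, pos 2 1, pos 2 2, pos 2 3).
    by rewrite !mxE /signx /signy /= => -[[[? ?] ?] ?]; split; lra.
have := pos (signx j * X) (signy j * Y).
rewrite mxE /signx /signy.
case: j => [] [|[|[|[|j]]]] //= ?;
rewrite !normrM ?normrN !normr1 !mul1r => /(_ erefl erefl) [];
case: i => [] [|[|[|[|i]]]] //= ?; lra.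
Qed.

(** * Nonnegative weights in the parameter regions *)

(** (H) cleared of its denominators; as in [nonneg_weights], the equations on
    norms range over the four choices of signs. *)
Definition signed_condH s sxy X Y : Prop :=
  forall x y, `|x| = `|X| -> `|y| = `|Y| ->
  4 * (sxy - s * (2 - s)) <=
    ((2 * s - sxy) * x + sxy) * ((2 * s - sxy) * y + sxy).

(** Each left-hand side of (H) is a difference of two squares, hence a product
    of two affine factors, one in [X] only and the other in [Y] only. *)
Lemma condHP (lambda : R) s sxy X Y : 0 < lambda -> sxy < 2 * s ->
  condH lambda s sxy (lambda * X, lambda * Y) ->
  signed_condH s sxy X Y.
Proof.
move=> l0; rewrite -subr_gt0 /condH /gamma /= => d0.
have dN0 : 2 * s - sxy != 0 by rewrite gt_eqF.
have scale E x y :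
    E = 4 * lambda ^+ 2 * (x + sxy / (2 * s - sxy))
          * (y + sxy / (2 * s - sxy)) ->
    16 * lambda ^+ 2 / (2 * s - sxy) ^+ 2 * (sxy - s * (2 - s)) <= E ->
    4 * (sxy - s * (2 - s)) <=
      ((2 * s - sxy) * x + sxy) * ((2 * s - sxy) * y + sxy).
  move=> ->; set a := (leLHS in leLHS <= _ -> _).
  set b := (leRHS in _ <= leRHS -> _).
  have k0 : 0 < (2 * s - sxy) ^+ 2 / (4 * lambda ^+ 2).
    by rewrite divr_gt0 ?exprn_gt0 ?mulr_gt0 ?exprn_gt0.
  move=> /(ler_wpM2l (ltW k0)); congr (_ <= _); rewrite /a /b; field;
    by rewrite dN0 gt_eqF.
(* The square of [Wx +- g] gives [x] and [y] the signs of [X] and [Y], or both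
   opposite signs; that of [Wy +- g] reverses exactly one of them. *)
case=> Hpp Hmm Hpm Hmp x y /eqP + /eqP.
rewrite !eqr_norm2 => /orP[] /eqP -> /orP[] /eqP ->.
- by apply: (scale _ _ _ _ Hpp); field.
- by apply: (scale _ _ _ _ Hpm); field.
- by apply: (scale _ _ _ _ Hmp); field.
- by apply: (scale _ _ _ _ Hmm); field.
Qed.

(** Multiplied by [2 * s - sxy], the weight of the velocities left unchanged is
    the difference of the two sides of (H). *)
Lemma bulk_weight_ge0 s sxy x y : sxy < 2 * s ->
  4 * (sxy - s * (2 - s)) <=
    ((2 * s - sxy) * x + sxy) * ((2 * s - sxy) * y + sxy) ->
  0 <= 4 - 2 * s * (1 - x * y) - sxy * ((1 - x) * (1 - y)).
Proof.
rewrite -subr_gt0 => d0 H; rewrite -(pmulr_rge0 _ d0); move: H.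
rewrite -subr_ge0; congr (0 <= _); ring.
Qed.

Lemma nonneg_weights_of s sxy X Y :
  sxy <= 2 * s -> `|X| <= 1 -> `|Y| <= 1 ->
  (2 * s - sxy) * `|X| <= sxy -> (2 * s - sxy) * `|Y| <= sxy ->
  (forall x y, `|x| = `|X| -> `|y| = `|Y| ->
     0 <= 4 - 2 * s * (1 - x * y) - sxy * ((1 - x) * (1 - y))) ->
  nonneg_weights s sxy X Y.
Proof.
rewrite -(subr_ge0 sxy) => d0 X1 Y1 dX dY bulk x y xX yY.
have cross (z : R) :
    (2 * s - sxy) * `|z| <= sxy -> 0 <= sxy + (2 * s - sxy) * z.
  rewrite -[X in X * `|z|]ger0_norm // -normrM ler_norml => /andP[? _].
  by rewrite -lerBlDl sub0r.
have one (z : R) : `|z| <= 1 -> 0 <= 1 + z.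
  by rewrite ler_norml => /andP[? _]; rewrite -lerBlDl sub0r.
rewrite -xX in X1 dX; rewrite -yY in Y1 dY.
split; first exact: bulk.
- by rewrite mulr_ge0 ?one ?cross.
- by rewrite mulr_ge0 ?one ?cross.
- by rewrite !mulr_ge0 ?one.
Qed.

(** The weight of the unchanged velocities is affine in [x] and in [y], with
    values 4, 4 (1 - s) and 4 (1 - sxy) at the corners where [|x| = |y| = 1].
    These are nonnegative, and interpolation extends this to the square. *)
Lemma nonneg_weights1 s sxy X Y : params1 s sxy ->
  `|X| <= 1 -> `|Y| <= 1 -> nonneg_weights s sxy X Y.
Proof.
rewrite /params1 le_min => /and3P[h1 h2 h3] X1 Y1.
apply: nonneg_weights_of => // [||x y xX yY]; try nra.
rewrite -xX in X1; rewrite -yY in Y1.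
move: X1 Y1; rewrite !ler_norml => /andP[? ?] /andP[? ?].
have -> : 4 - 2 * s * (1 - x * y) - sxy * ((1 - x) * (1 - y)) =
  (1 + x) * (1 + y) + (1 - s) * ((1 - x) * (1 + y))
  + (1 - s) * ((1 + x) * (1 - y)) + (1 - sxy) * ((1 - x) * (1 - y)) by ring.
by rewrite !addr_ge0 // !mulr_ge0 //; lra.
Qed.

Lemma nonneg_weights2 s sxy X Y : params2 s sxy ->
  `|X| <= 1 -> `|Y| <= 1 -> signed_condH s sxy X Y ->
  nonneg_weights s sxy X Y.
Proof.
rewrite /params2 ge_max => -[h1 /andP[/andP[h2 h3] h4]] X1 Y1 H.
apply: nonneg_weights_of => // [|||x y xX yY]; try nra.
by apply: bulk_weight_ge0 => //; apply: H.
Qed.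

(** Here [sxy <= 2 * s - sxy], so the bound by [gamma] implies the bound by 1,
    and (H) holds because its product of factors is nonnegative, whereas
    [sxy - s * (2 - s)] is nonpositive. *)
Lemma nonneg_weights3 s sxy X Y : params3 s sxy ->
  `|X| <= gamma s sxy -> `|Y| <= gamma s sxy -> nonneg_weights s sxy X Y.
Proof.
rewrite /params3 le_min /gamma => /and3P[h1 h2 h3].
have [d0|d0] := ltP sxy (2 * s); last first.
  (* Only the point (0, 0) remains, and there [gamma] is 0. *)
  have -> : s = 0 by lra.
  have -> : sxy = 0 by lra.
  rewrite mul0r !normr_le0 => /eqP -> /eqP -> x y.
  by rewrite !normr0 => /normr0_eq0 -> /normr0_eq0 ->; split; lra.
rewrite !ler_pdivlMr ?subr_gt0 // => X1 Y1.
have dge : s <= 2 * s - sxy by lra.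
have bound (z : R) : `|z| * (2 * s - sxy) <= sxy -> `|z| <= 1.
  move=> zs; rewrite -(ler_pM2r (_ : 0 < 2 * s - sxy)) ?subr_gt0 // mul1r.
  by apply: le_trans zs _; lra.
apply: nonneg_weights_of; [exact: ltW|exact: bound|exact: bound
  |by rewrite mulrC|by rewrite mulrC|move=> x y xX yY].
apply: bulk_weight_ge0 => //.
have low (z : R) : `|z| * (2 * s - sxy) <= sxy -> 0 <= (2 * s - sxy) * z + sxy.
  rewrite -[X in _ * X <= _]gtr0_norm ?subr_gt0 // -normrM ler_norml mulrC.
  by rewrite -lerBlDr sub0r => /andP[].
apply: (@le_trans _ _ 0); first lra.
by rewrite mulr_ge0 // low // ?xX ?yY.
Qed.

(** (H) alone bounds the velocity. Its product of factors is nonnegative since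
    [sxy - s * (2 - s)] is, and taking one positive and one negative sign makes
    one factor positive; the other is then nonnegative, which is the bound by
    [gamma], at most 1 here. *)
Lemma nonneg_weights4 s sxy X Y : params4 s sxy ->
  signed_condH s sxy X Y -> nonneg_weights s sxy X Y.
Proof.
rewrite /params4 le_min => -[h0 /and3P[h1 h2 h3]] H.
have d0 : 0 < 2 * s - sxy by lra.
have side x y : 4 * (sxy - s * (2 - s)) <=
    ((2 * s - sxy) * `|x| + sxy) * ((2 * s - sxy) * - `|y| + sxy) ->
    (2 * s - sxy) * `|y| <= sxy.
  move=> h.
  have : 0 <= ((2 * s - sxy) * `|x| + sxy) * ((2 * s - sxy) * - `|y| + sxy).
    by apply: le_trans h; lra.
  rewrite pmulr_rge0; first by lra.
  by apply: ltr_wpDl => //; rewrite mulr_ge0 // ltW.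
have dX : (2 * s - sxy) * `|X| <= sxy.
  apply: (side Y X); rewrite [leRHS]mulrC.
  by apply: H; rewrite ?normrN !normr_id.
have dY : (2 * s - sxy) * `|Y| <= sxy.
  by apply: (side X Y); apply: H; rewrite ?normrN !normr_id.
have bound (z : R) : (2 * s - sxy) * `|z| <= sxy -> `|z| <= 1.
  move=> zs; rewrite -(ler_pM2l d0) mulr1.
  by apply: le_trans zs _; lra.
apply: nonneg_weights_of; rewrite ?bound //; first lra.
by move=> x y xX yY; apply: bulk_weight_ge0; [lra|apply: H].
Qed.

(** With [sxy = 2 * s] only the weight of the unchanged velocities,
    [4 - 2 * sxy + sxy * (x + y)], is not obviously nonnegative; it is smallest
    at [x = - |X|] and [y = - |Y|]. *)
Lemma nonneg_weights5 s sxy X Y : params5 s sxy ->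
  `|X| <= 1 -> `|Y| <= 1 -> `|X| + `|Y| <= 2 * ((2 - sxy) / sxy) ->
  nonneg_weights s sxy X Y.
Proof.
rewrite /params5 => -[h1 /andP[h2 h3]] X1 Y1.
rewrite mulrA ler_pdivlMr // => N1.
apply: nonneg_weights_of => //; try (by rewrite -h1 subrr mul0r ltW).
  by rewrite h1.
move=> x y xX yY; rewrite -xX -yY in N1.
rewrite -h1 (_ : _ - _ = 4 - 2 * sxy + sxy * (x + y)); last by ring.
have : - (`|x| + `|y|) <= x + y.
  by have := ler_norm (- x); have := ler_norm (- y); rewrite !normrN; lra.
move=> /(ler_wpM2l (ltW h2)); lra.
Qed.

Lemma nonneg_weights6 X Y : nonneg_weights 0 0 X Y.
Proof. by move=> x y _ _; split; lra. Qed.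

(** Adding the weights over opposite signs cancels the velocity, and leaves
    inequalities between [s] and [sxy] alone. *)
Lemma params_of_nonneg_weights s sxy X Y : nonneg_weights s sxy X Y ->
  params1 s sxy \/ params2 s sxy \/ params3 s sxy \/ params4 s sxy \/
  params5 s sxy \/ params6 s sxy.
Proof.
move=> pos; rewrite /params1 /params2 /params3 /params4 /params5 /params6.
rewrite !le_min !ge_max.
have gt1 (z : R) : 0 < 1 + `|z| by rewrite ltr_pwDl.
have [||wpp cpp _ dpp] := pos `|X| `|Y|; rewrite ?normr_id //.
have [||wmp cmp _ _] := pos (- `|X|) `|Y|; rewrite ?normrN ?normr_id //.
have [||wpm _ _ _] := pos `|X| (- `|Y|); rewrite ?normrN ?normr_id //.
have [||wmm _ _ _] := pos (- `|X|) (- `|Y|); rewrite ?normrN ?normr_id //.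
move: cpp cmp dpp; rewrite [0 <= (2 * s - sxy) * _]pmulr_lge0 ?mulr_gt0 //.
rewrite !(pmulr_rge0 _ (gt1 _)) => cpp cmp d0.
have sxy0 : 0 <= sxy by lra.
have top : sxy <= 2 * (2 - s) by lra.
have [dE|dN] := eqVneq sxy (2 * s).
  have [s0|sN] := eqVneq sxy 0; first by do 5 right; split; lra.
  by do 4 right; left; split=> //; rewrite lt0r sN sxy0 /=; lra.
have {dN d0} d0 : sxy < 2 * s by rewrite lt_neqAle dN -subr_ge0.
have [ss|ss] := leP s sxy.
  have [s1|s1] := leP sxy 1; first by left; rewrite /= ltW.
  by right; left; rewrite (ltW s1) top.
have [sq|sq] := leP sxy (s * (2 - s)).
  by do 2 right; left; rewrite sxy0 (ltW ss).
do 3 right; left; rewrite (ltW sq) (ltW ss) top; split=> //.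
by apply: le_lt_trans sq; rewrite mulr_ge0; lra.
Qed.

Lemma params_in_square s sxy :
  params1 s sxy \/ params2 s sxy \/ params3 s sxy \/ params4 s sxy \/
  params5 s sxy \/ params6 s sxy ->
  0 <= s <= 2 /\ 0 <= sxy <= 2.
Proof.
rewrite /params1 /params2 /params3 /params4 /params5 /params6 !le_min !ge_max.
move=> [/and3P[? ? ?]|[[? /andP[/andP[? ?] ?]]|[/and3P[? ? ?]|
  [[? /and3P[? ? ?]]|[[? /andP[? ?]]|[? ?]]]]]];
  by split; apply/andP; split; nra.
Qed.

(** * The stability criterion *)

Lemma stableP (dx dt : R) (hdx : 0 < dx) (hdt : 0 < dt) sq sxy V :
  stable dx dt sq sxy V <->
  nonneg_weights sq sxy (V.1 / (dx / dt)) (V.2 / (dx / dt)).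
Proof.
have l0 : dx / dt != 0 by rewrite gt_eqF // divr_gt0.
rewrite /stable -collision_mx_ge0P -(collide_nonnegP (dx / dt)) //.
rewrite ![dx / dt * _]mulrC !divfK // -surjective_pairing.
by apply: Linf_stableP => //; rewrite mxE.
Qed.

End Stability.

Theorem proposition3p6 (R : realType) (dx dt : R) (hdx : 0 < dx) (hdt : 0 < dt)
    (sq sxy : R) :
  let lambda := dx / dt in
  (params1 sq sxy -> forall V : R * R,
     norm_inf V <= lambda -> stable dx dt sq sxy V) /\
  (params2 sq sxy -> forall V : R * R,
     norm_inf V <= lambda -> condH lambda sq sxy V -> stable dx dt sq sxy V) /\
  (params3 sq sxy -> forall V : R * R,
     norm_inf V <= lambda * gamma sq sxy -> stable dx dt sq sxy V) /\
  (params4 sq sxy -> forall V : R * R,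
     condH lambda sq sxy V -> stable dx dt sq sxy V) /\
  (~ (params1 sq sxy \/ params2 sq sxy \/ params3 sq sxy \/ params4 sq sxy \/
      params5 sq sxy \/ params6 sq sxy) ->
   forall V : R * R, ~ stable dx dt sq sxy V) /\
  (params5 sq sxy -> forall V : R * R,
     norm_inf V <= lambda -> norm_one V <= 2 * lambda * ((2 - sxy) / sxy) ->
     stable dx dt sq sxy V) /\
  (params6 sq sxy -> forall V : R * R, stable dx dt sq sxy V) /\
  ((exists V : R * R, stable dx dt sq sxy V) ->
   (0 <= sq <= 2) /\ (0 <= sxy <= 2)).
Proof.
move=> lambda.
have l0 : 0 < lambda by rewrite divr_gt0.
have normE z : `|z / lambda| = `|z| / lambda.
  by rewrite normrM normfV (gtr0_norm l0).
have infP (V : R * R) (c : R) : norm_inf V <= lambda * c ->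
    `|V.1 / lambda| <= c /\ `|V.2 / lambda| <= c.
  by rewrite /norm_inf ge_max !normE !ler_pdivrMr // ![c * _]mulrC => /andP.
have inf1P (V : R * R) : norm_inf V <= lambda ->
    `|V.1 / lambda| <= 1 /\ `|V.2 / lambda| <= 1.
  by move=> h; apply: infP; rewrite mulr1.
have rescale (V : R * R) :
    V = (lambda * (V.1 / lambda), lambda * (V.2 / lambda)).
  by rewrite ![lambda * _]mulrC !divfK ?gt_eqF // -surjective_pairing.
have stP V := stableP R dx dt hdx hdt sq sxy V.
have classify V : stable dx dt sq sxy V ->
    params1 sq sxy \/ params2 sq sxy \/ params3 sq sxy \/ params4 sq sxy \/
    params5 sq sxy \/ params6 sq sxy.
  by move=> /stP; apply: params_of_nonneg_weights.
split; [|split; [|split; [|split; [|split; [|split; [|split]]]]]].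
- by move=> p V /inf1P[X1 Y1]; apply/stP; apply: nonneg_weights1.
- move=> p V /inf1P[X1 Y1]; rewrite {1}(rescale V) => H; apply/stP.
  by apply: nonneg_weights2 => //; apply: condHP H => //; case: p.
- by move=> p V /infP[X1 Y1]; apply/stP; apply: nonneg_weights3.
- move=> p V; rewrite {1}(rescale V) => H; apply/stP.
  apply: nonneg_weights4 => //; apply: condHP H => //.
  by move: p; rewrite /params4 le_min => -[? /and3P[? ? ?]]; lra.
- by move=> out V /classify.
- move=> p V /inf1P[X1 Y1] N1; apply/stP; apply: nonneg_weights5 => //.
  rewrite !normE -mulrDl ler_pdivrMr //.
  by rewrite [leRHS]mulrC mulrCA mulrA.
- by case=> -> -> V; apply/stableP => //; apply: nonneg_weights6.
- by case=> V /classify; apply: params_in_square.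
Qed.
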